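(* Let $\Sigma$ be a compact oriented hyperbolic surface, possibly with boundary components $\zeta_1,\dots,\zeta_b$, and let $\xi$ be a non-separating essential simple closed curve such that $\Sigma_0=\Sigma\setminus\xi$ is a hyperbolic subsurface. Let $\Gamma=\pi_1(\Sigma)$ and $\mathcal S=\{\langle\xi\rangle,\langle\zeta_1\rangle,\dots,\langle\zeta_b\rangle\}$. Choose a boundary frame $\mathscr B$ and a $\{\xi\}$-frame $\mathscr C$. Let $[\rho]\in\overline{\mathcal X}_n^{\mathscr B}(\Gamma,\mathscr C)$ be such that $[\rho_{\Gamma_{\Sigma_0}}]\in\overline{\mathcal X}_n^{\mathscr B_0}(\Gamma_{\Sigma_0})$, where $$\mathscr B_0=\{(\zeta,B)\mid\zeta\text{ is a component of }\partial\overline{\Sigma_0}\text{ and }(\iota_{\Sigma_0}(\zeta),B)\in\mathscr B\cup\mathscr C\}.$$ Fix a representation $\rho$ in $[\rho]$. Then for all $[\alpha],[\beta]\in H^1_{\mathrm{par}}(\Gamma,\mathcal S;\mathfrak g_\rho)$, $$\omega_K^\Sigma([\alpha],[\beta])=\omega_K^{\Sigma_0}(\iota_{\Sigma_0}^*[\alpha],\iota_{\Sigma_0}^*[\beta]).$$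
   Context: $G=\mathrm{PSL}_n(\mathbb R)$, $\mathfrak g=\mathfrak{sl}_n(\mathbb R)$. A compact oriented hyperbolic surface is a compact connected oriented surface of negative Euler characteristic; essential means not homotopic to a point or a boundary component. $\overline{\Sigma_0}$ is the completion of $\Sigma_0$ (two boundary components of which correspond to $\xi$) and $\iota_{\Sigma_0}:\overline{\Sigma_0}\to\Sigma$ extends the inclusion. $\Gamma_{\Sigma_0}\cong\pi_1(\Sigma_0)$ is the vertex subgroup of $\Gamma$ in the HNN splitting of $\Gamma$ along $\langle\xi\rangle$, and $\rho_{\Gamma_{\Sigma_0}}$ is the restriction of $\rho$. $\overline{\mathcal X}_n(\Gamma)=\{\rho\in\mathrm{Hom}(\Gamma,G):\rho\text{ irreducible},\ Z_G(\rho)=\{1\}\}/G$, $Z_G(\rho)$ being the centralizer of the image. A boundary frame assigns a conjugacy class $B_i$ of $G$ to each $\zeta_i$; a $\{\xi\}$-frame is $\{(\xi,C)\}$ with $C$ a conjugacy class of $G$. $\overline{\mathcal X}_n^{\mathscr B}(\Gamma)$ is the set of $[\rho]\in\overline{\mathcal X}_n(\Gamma)$ with $\rho(\zeta_i)\in B_i$ for all $i$, and $\overline{\mathcal X}_n^{\mathscr B}(\Gamma,\mathscr C)$ is the subset with $\rho(\xi)\in C$. (For $\mathscr B_0$, boundary components carry the orientation for which $\iota_{\Sigma_0}$ takes them to the corresponding oriented curves.) $\mathfrak g_\rho$ is $\mathfrak g$ with $\gamma\cdot X=\mathrm{Ad}_{\rho(\gamma)}X$. Cocycles: maps $\alpha:\Gamma\to\mathfrak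 g$ with $\alpha(xy)=\alpha(x)+x\cdot\alpha(y)$; coboundaries: $d_\Gamma X(\gamma)=\gamma\cdot X-X$. For a finite family $\mathcal S$ of subgroups (given up to conjugacy), $Z^1_{\mathrm{par}}(\Gamma,\mathcal S;\mathfrak g_\rho)$ is the space of cocycles restricting to a coboundary on each member of $\mathcal S$, and $H^1_{\mathrm{par}}=Z^1_{\mathrm{par}}/B^1$. Restriction of cocycles induces $\iota_{\Sigma_0}^*:H^1_{\mathrm{par}}(\Gamma,\mathcal S;\mathfrak g_\rho)\to H^1_{\mathrm{par}}(\Gamma_{\Sigma_0},\mathcal S_0;\mathfrak g_{\rho_{\Gamma_{\Sigma_0}}})$, where $\mathcal S_0=\{\langle\zeta\rangle\subset\Gamma_{\Sigma_0}:\zeta\text{ a component of }\partial\overline{\Sigma_0}\}$. The pairing $\omega_K^\Sigma$: fix a presentation, compatible with the orientation, $\Gamma=\langle x_1,y_1,\dots,x_g,y_g,z_1,\dots,z_b\mid R\rangle$, $R=\prod_i[x_i,y_i]\prod_jz_j$, with $z_j$ representing $\zeta_j$ (same convention for $\Sigma_0$ with induced orientation). With Fox derivatives, cocycles extended linearly to $\mathbb R\Gamma$, and $\overline{(\cdot)}$ induced by inversion, $\langle\alpha\smile\beta,[\Sigma]\rangle=-\sum_s\mathrm{Tr}\,\alpha(\overline{\partial R/\partial s})\beta(s)$, the sum over all generators $s$. For $[\alpha],[\beta]\in H^1_{\mathrm{par}}(\Gamma,\{\langle\zeta_j\rangle\};\mathfrak g_\rho)$, which contains $H^1_{\mathrm{par}}(\Gamma,\mathcal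 S;\mathfrak g_\rho)$, $\omega_K^\Sigma([\alpha],[\beta])=\langle\alpha\smile\beta,[\Sigma]\rangle-\sum_{j=1}^b\mathrm{Tr}\,X_j\beta(z_j)$ with $X_j\in\mathfrak g$ such that $\alpha(z_j)=z_j\cdot X_j-X_j$. This is well defined. *)

(* Defs.v *)
From HB Require Import structures.
From mathcomp Require Import all_boot all_order all_algebra.
From mathcomp Require Import boolp classical_sets functions reals.

Set Implicit Arguments.
Unset Strict Implicit.
Unset Printing Implicit Defensive.

Import GRing.Theory.
Local Open Scope ring_scope.
Local Open Scope classical_set_scope.
Local Open Scope quotient_scope.

(** * The group PSL_n(F) = SL_n(F) / scalars *)

Record SL (F : fieldType) (n : nat) :=
  MkSL { slval :> 'M[F]_n ; sl_det : \det slval == 1 }.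

HB.instance Definition _ (F : fieldType) n := [isSub for @slval F n].
HB.instance Definition _ (F : fieldType) n := [Choice of SL F n by <:].

Section SLGroup.
Context {F : fieldType} {n : nat}.
Implicit Types A B C : SL F n.

Fact sl_unit A : slval A \in unitmx.
Proof. by rewrite unitmxE (eqP (sl_det A)) unitr1. Qed.

Fact sl_mul_subproof A B : \det (slval A *m slval B) == 1.
Proof. by rewrite det_mulmx (eqP (sl_det A)) (eqP (sl_det B)) mulr1. Qed.

Fact sl_one_subproof : \det (1%:M : 'M[F]_n) == 1.
Proof. by rewrite det1. Qed.

Fact sl_inv_subproof A : \det (invmx (slval A)) == 1.
Proof. by rewrite det_inv (eqP (sl_det A)) invr1. Qed.

Definition sl_mul A B := MkSL (sl_mul_subproof A B).
Definition sl_one := MkSL sl_one_subproof.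
Definition sl_inv A := MkSL (sl_inv_subproof A).

Fact sl_mulA : associative sl_mul.
Proof. by move=> A B C; apply: val_inj; rewrite /= mulmxA. Qed.
Fact sl_mul1 : left_id sl_one sl_mul.
Proof. by move=> A; apply: val_inj; rewrite /= mul1mx. Qed.
Fact sl_mulr1 : right_id sl_one sl_mul.
Proof. by move=> A; apply: val_inj; rewrite /= mulmx1. Qed.
Fact sl_mulV : left_inverse sl_one sl_inv sl_mul.
Proof. by move=> A; apply: val_inj; rewrite /= mulVmx ?sl_unit. Qed.
Fact sl_mulrV : right_inverse sl_one sl_inv sl_mul.
Proof. by move=> A; apply: val_inj; rewrite /= mulmxV ?sl_unit. Qed.

HB.instance Definition _ := isGroup.Build (SL F n)
  sl_mulA sl_mul1 sl_mulr1 sl_mulV sl_mulrV.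

Fact slvalM A B : slval (A * B)%g = slval A *m slval B. Proof. by []. Qed.
Fact slvalV A : slval (A^-1)%g = invmx (slval A). Proof. by []. Qed.

Definition psl_rel A B := is_scalar_mx (slval (A^-1 * B)%g).

Fact psl_relP A B : reflect (exists a, slval B = a *: slval A) (psl_rel A B).
Proof.
apply: (iffP is_scalar_mxP) => [[a e]|[a e]]; exists a.
  have /(congr1 (@slval F n)) : B = (A * (A^-1 * B))%g by rewrite mulVKg.
  by move=> ->; rewrite -mul_mx_scalar -e.
rewrite slvalM slvalV e -scalemxAr mulVmx ?sl_unit //.
by rewrite scalemx1.
Qed.

Fact psl_rel_equiv : equiv_class_of psl_rel.
Proof.
have sym A B : psl_rel A B -> psl_rel B A.
  move=> /psl_relP[a e]; apply/psl_relP; exists a^-1.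
  have [a0|a0] := eqVneq a 0; last by rewrite e scalerA mulVf // scale1r.
  have e0 : slval B = 0 by rewrite e a0 scale0r.
  have id0 : (1%:M : 'M[F]_n) = 0.
    by rewrite -(mulVmx (sl_unit B)) {2}e0 mulmx0.
  by rewrite -[LHS]mulmx1 -[RHS]mulmx1 id0 !mulmx0.
split => [A|A B|B A C].
- by apply/psl_relP; exists 1; rewrite scale1r.
- by apply/idP/idP; apply: sym.
- move=> /psl_relP[a ea] /psl_relP[c ec]; apply/psl_relP; exists (c * a).
  by rewrite ec ea scalerA.
Qed.

Canonical psl_equiv := EquivRelPack psl_rel_equiv.
End SLGroup.

Definition PSL (F : fieldType) (n : nat) := {eq_quot (@psl_equiv F n)}.
HB.instance Definition _ (F : fieldType) n := Choice.on (PSL F n).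
HB.instance Definition _ (F : fieldType) n :=
  EqQuotient.on (PSL F n).

Section PSLGroup.
Context {F : fieldType} {n : nat}.
Local Notation G := (PSL F n).

Definition psl_mul (a b : G) : G := \pi_G (repr a * repr b)%g.
Definition psl_one : G := \pi_G 1%g.
Definition psl_inv (a : G) : G := \pi_G ((repr a)^-1)%g.

Fact psl_piP (A B : SL F n) :
  \pi_G A = \pi_G B <-> exists a, slval B = a *: slval A.
Proof.
by split=> [/eqquotP/psl_relP|/psl_relP e] //; apply/eqquotP.
Qed.

Fact psl_reprP (A : SL F n) : exists a, slval A = a *: slval (repr (\pi_G A)).
Proof. by apply/psl_piP; rewrite reprK. Qed.

Fact psl_pi_mul (A B : SL F n) : psl_mul (\pi_G A) (\pi_G B) = \pi_G (A * B)%g.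
Proof.
have [a ea] := psl_reprP A; have [b eb] := psl_reprP B.
apply/psl_piP; exists (a * b).
by rewrite !slvalM ea eb -scalemxAl -scalemxAr scalerA.
Qed.

Fact psl_mulA : associative psl_mul.
Proof.
elim/quotW=> a; elim/quotW=> b; elim/quotW=> c.
by rewrite (psl_pi_mul a b) (psl_pi_mul b c) !psl_pi_mul mulgA.
Qed.
Fact psl_mul1 : left_id psl_one psl_mul.
Proof. by elim/quotW=> a; rewrite psl_pi_mul mul1g. Qed.
Fact psl_mulr1 : right_id psl_one psl_mul.
Proof. by elim/quotW=> a; rewrite psl_pi_mul mulg1. Qed.
Fact psl_mulV : left_inverse psl_one psl_inv psl_mul.
Proof. by move=> a; rewrite -{2}[a]reprK psl_pi_mul mulVg. Qed.
Fact psl_mulrV : right_inverse psl_one psl_inv psl_mul.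
Proof. by move=> a; rewrite -{1}[a]reprK psl_pi_mul mulgV. Qed.

HB.instance Definition _ := isGroup.Build (PSL F n)
  psl_mulA psl_mul1 psl_mulr1 psl_mulV psl_mulrV.

(* Independent of the representative, two of which differ by a scalar. *)
Definition Ad (a : PSL F n) (X : 'M[F]_n) : 'M[F]_n :=
  slval (repr a) *m X *m invmx (slval (repr a)).
End PSLGroup.

Definition sl (F : fieldType) (n : nat) : set 'M[F]_n := [set X | \tr X = 0].

Definition is_hom (G H : groupType) (f : G -> H) :=
  {morph f : x y / (x * y)%g >-> (x * y)%g}.

(** * Words, Fox derivatives, presentations of surface groups *)

(* (s, false) is the generator s and (s, true) is its inverse. *)
Definition word (I : Type) := seq (I * bool).

Section Words.
Context {I : Type}.
Implicit Types (w u v : word I).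

Definition weval (H : groupType) (f : I -> H) w : H :=
  (\prod_(l <- w) (if l.2 then (f l.1)^-1 else f l.1))%g.

Definition winv w : word I := rev [seq (l.1, ~~ l.2) | l <- w].

(* The topologists' commutator u v u^-1 v^-1, not [~ u, v]. *)
Definition wcomm u v : word I := u ++ v ++ winv u ++ winv v.

Definition wconj u v : word I := u ++ v ++ winv u.

(* Equality in the free group on I. *)
Definition free_eq w v :=
  forall (H : groupType) (f : I -> H), weval f w = weval f v.
End Words.

Definition wsubst (I J : Type) (w : I -> word J) (v : word I) : word J :=
  flatten [seq (if l.2 then winv (w l.1) else w l.1) | l <- v].

(* An element of the integral group ring of the free group is represented by a
   formal sum, i.e. a list of pairs (coefficient, word).  The recursion is
   d(l v)/ds = dl/ds + l dv/ds for a letter l, with ds/ds = 1 and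
   d(s^-1)/ds = - s^-1. *)
Fixpoint fox (I : eqType) (s : I) (w : word I) : seq (int * word I) :=
  if w is l :: v then
    (if l.1 == s then [:: (if l.2 then (-1, [:: l]) else (1, [::]))] else [::])
    ++ [seq (c.1, l :: c.2) | c <- fox s v]
  else [::].

(* Generators x_i, y_i (i < g) and z_j (j < b). *)
Definition gen (g b : nat) : finType := ('I_g + 'I_g + 'I_b)%type.
Definition gX g b (i : 'I_g) : gen g b := inl (inl i).
Definition gY g b (i : 'I_g) : gen g b := inl (inr i).
Definition gZ g b (j : 'I_b) : gen g b := inr j.
Arguments gX {g} b i.
Arguments gY {g} b i.
Arguments gZ g {b} j.

Definition surf_rel (g b : nat) : word (gen g b) :=
  flatten [seq wcomm [:: (gX b i, false)] [:: (gY b i, false)] | i <- enum 'I_g]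
  ++ [seq (gZ g j, false) | j <- enum 'I_b].

(* Negative Euler characteristic, 2 - 2g - b < 0. *)
Definition hyperbolic (g b : nat) := (2 < g.*2 + b)%N.

Definition surface_presentation (g b : nat) (Gam : groupType)
    (p : gen g b -> Gam) : Prop :=
  weval p (surf_rel g b) = 1%g /\
  forall (H : groupType) (f : gen g b -> H), weval f (surf_rel g b) = 1%g ->
    exists! F : Gam -> H, is_hom F /\ (forall s, F (p s) = f s).

(* Two presentations p, q of the fundamental group of one surface, with the
   same numbering of its oriented boundary components, induce the same
   orientation: the z_j of p and q are conjugate, and the relator of q,
   rewritten in the generators of p, is a product of conjugates of the relator
   r of p and of its inverse with total exponent +1.  By Hopf's formula
   H_2 = (N ∩ [F, F]) / [F, N], where N is the normal closure of r in the free
   group F, so for a closed surface the last condition says that p and q have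
   the same fundamental class; the opposite orientation has exponent -1.  If
   there is a boundary, the conjugacy of the z_j forces the exponent. *)
Definition same_orientation (g b : nat) (Gam : groupType)
    (p q : gen g b -> Gam) : Prop :=
  exists (w : gen g b -> word (gen g b)) (u : 'I_b -> word (gen g b))
         (e : seq (bool * word (gen g b))),
  [/\ forall s, weval p (w s) = q s,
      forall j, w (gZ g j) = wconj (u j) [:: (gZ g j, false)],
      free_eq (wsubst w (surf_rel g b))
        (flatten [seq wconj c.2 (if c.1 then winv (surf_rel g b)
                                 else surf_rel g b) | c <- e])
    & \sum_(c <- e) (-1) ^+ c.1 = 1 :> int].

(** * Cutting along a non-separating simple closed curve *)

(* Gam is the HNN extension of Gam0 with stable letter t and t^-1 u t = v. *)
Definition is_HNN (Gam0 Gam : groupType) (iota : Gam0 -> Gam) (u v : Gam0)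
    (t : Gam) : Prop :=
  [/\ is_hom iota, injective iota, (iota u ^ t = iota v)%g
    & forall (H : groupType) (f : Gam0 -> H) (h : H),
        is_hom f -> (f u ^ h = f v)%g ->
        exists! F : Gam -> H,
          [/\ is_hom F, forall x, F (iota x) = f x & F t = h]].

Section Cut.
Context {g b : nat}.

(* The boundary components of the cut surface are numbered so that the first b
   are those of the original surface, and the last two are the two copies of
   the curve xi: on zplus the boundary orientation is that of xi, and on zminus
   it is the opposite one. *)
Definition zplus : gen g (b + 2) := gZ g (rshift b ord0).
Definition zminus : gen g (b + 2) := gZ g (rshift b ord_max).

(* The presentation of the glued surface coming from one of the cut surface:
   as z- = t^-1 z+^-1 t, with c = z_1 ... z_b one has
   z_1 ... z_b z+ z- = [c z+ c^-1, c t^-1 c^-1] z_1 ... z_b. *)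
Definition glued_presentation (Gam0 Gam : groupType) (iota : Gam0 -> Gam)
    (p0 : gen g (b + 2) -> Gam0) (t : Gam) (s : gen g.+1 b) : Gam :=
  let z (j : 'I_b) := iota (p0 (gZ g (lshift 2 j))) in
  let c := (\prod_(j < b) z j)%g in
  match s with
  | inl (inl i) => if unlift ord_max i is Some k then iota (p0 (gX _ k))
                   else (c * iota (p0 zplus) * c^-1)%g
  | inl (inr i) => if unlift ord_max i is Some k then iota (p0 (gY _ k))
                   else (c * t^-1 * c^-1)%g
  | inr j => z j
  end.

(* Gam0 (through iota) is the vertex group of the HNN splitting of Gam along
   xi, and the presentation p of Gam is compatible with the orientation that
   the surface presented by p shares with the cut surface presented by p0. *)
Definition nonseparating_cut (Gam0 Gam : groupType) (iota : Gam0 -> Gam)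
    (p : gen g.+1 b -> Gam) (p0 : gen g (b + 2) -> Gam0) (xi : Gam) : Prop :=
  (exists h, xi = iota (p0 zplus) ^ h)%g /\
  exists t : Gam,
    is_HNN iota (p0 zplus)^-1%g (p0 zminus) t /\
    same_orientation (glued_presentation iota p0 t) p.

(* The boundary components of the cut surface with the orientation carried
   over from the z_j and xi (which is not the boundary orientation on the
   second copy of xi). *)
Definition cut_loop (Gam0 : groupType) (p0 : gen g (b + 2) -> Gam0)
    (j : 'I_(b + 2)) : Gam0 :=
  match fintype.split j with
  | inl k => p0 (gZ g (lshift 2 k))
  | inr k => if k == ord0 then p0 zplus else (p0 zminus)^-1%g
  end.

Definition cut_frame (G : Type) (B : 'I_b -> set G) (C : set G)
    (j : 'I_(b + 2)) : set G :=
  match fintype.split j with inl k => B k | inr _ => C end.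
End Cut.

(** * Representations and character varieties *)

Definition conj_class (G : groupType) (C : set G) : Prop :=
  exists h : G, C = [set (h ^ k)%g | k in [set: G]].

Section Reps.
Context {R : realType} {n : nat} {Gam : groupType}.
Local Notation G := (PSL R n).

(* A subspace of R^n is given by the row space of U, and A acts on columns. *)
Definition irreducible_rep (rho : Gam -> G) : Prop :=
  forall U : 'M[R]_n,
    (forall x, (U *m (slval (repr (rho x)))^T <= U)%MS) ->
    \rank U = 0%N \/ \rank U = n.

Definition trivial_centralizer (rho : Gam -> G) : Prop :=
  forall h : G, (forall x, (h * rho x = rho x * h)%g) -> h = 1%g.

Definition good_rep (rho : Gam -> G) : Prop :=
  [/\ is_hom rho, irreducible_rep rho & trivial_centralizer rho].

Definition rep_class (rho : Gam -> G) : set (Gam -> G) :=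
  [set sigma | exists h : G, forall x, sigma x = (rho x ^ h)%g].

Definition Xbar : set (set (Gam -> G)) := [set rep_class rho | rho in good_rep].

Definition Xbar_frame (I : Type) (loops : I -> Gam) (B : I -> set G) :
    set (set (Gam -> G)) :=
  [set r | Xbar r /\ exists2 rho, r rho & forall i, B i (rho (loops i))].

Definition Xbar_frame_at (I : Type) (loops : I -> Gam) (B : I -> set G)
    (xi : Gam) (C : set G) : set (set (Gam -> G)) :=
  [set r | Xbar_frame loops B r /\ exists2 rho, r rho & C (rho xi)].

(** * Parabolic cohomology and the pairing *)

Definition coboundary (rho : Gam -> G) (X : 'M[R]_n) : Gam -> 'M[R]_n :=
  fun x => Ad (rho x) X - X.

Definition cocycle (rho : Gam -> G) (alpha : Gam -> 'M[R]_n) : Prop :=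
  (forall x, sl (alpha x)) /\
  (forall x y, alpha (x * y)%g = alpha x + Ad (rho x) (alpha y)).

Definition cyc (x : Gam) : set Gam :=
  [set y | exists k : nat, (y = x ^+ k \/ y = x ^- k)%g].

Definition Z1par (rho : Gam -> G) (S : set (set Gam)) : set (Gam -> 'M[R]_n) :=
  [set alpha | cocycle rho alpha /\
     forall D, S D -> exists2 X, sl X &
       forall x, D x -> alpha x = coboundary rho X x].

(* Cohomology classes are cosets of the space of coboundaries. *)
Definition coh_class (rho : Gam -> G) (alpha : Gam -> 'M[R]_n) :
    set (Gam -> 'M[R]_n) :=
  [set alpha' | exists2 X, sl X & forall x, alpha' x = alpha x + coboundary rho X x].

Definition H1par (rho : Gam -> G) (S : set (set Gam)) :
    set (set (Gam -> 'M[R]_n)) :=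
  [set coh_class rho alpha | alpha in Z1par rho S].

Definition peripheral (I : Type) (loops : I -> Gam) (xi : Gam) : set (set Gam) :=
  [set cyc xi] `|` [set cyc (loops i) | i in [set: I]].

Definition cup_fund (g b : nat) (p : gen g b -> Gam)
    (alpha beta : Gam -> 'M[R]_n) : R :=
  - \sum_(s : gen g b)
      \tr ((\sum_(c <- fox s (surf_rel g b)) alpha (weval p c.2)^-1%g *~ c.1)
           *m beta (p s)).

Definition omega_cocycle (g b : nat) (p : gen g b -> Gam) (rho : Gam -> G)
    (alpha beta : Gam -> 'M[R]_n) : R :=
  let X j := xget 0 [set X | sl X /\
    alpha (p (gZ g j)) = Ad (rho (p (gZ g j))) X - X] in
  cup_fund p alpha beta - \sum_(j < b) \tr (X j *m beta (p (gZ g j))).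

(* The value does not depend on the representatives chosen in the classes. *)
Definition omegaK (g b : nat) (p : gen g b -> Gam) (rho : Gam -> G)
    (a1 a2 : set (Gam -> 'M[R]_n)) : R :=
  omega_cocycle p rho (xget (fun=> 0) a1) (xget (fun=> 0) a2).
End Reps.

Definition res_class (R : realType) (n : nat) (Gam0 Gam : groupType)
    (iota : Gam0 -> Gam) (rho : Gam -> PSL R n)
    (a : set (Gam -> 'M[R]_n)) : set (Gam0 -> 'M[R]_n) :=
  [set alpha0 | exists2 alpha, a alpha &
     coh_class (rho \o iota) (alpha \o iota) alpha0].

(* Main.v *)
Require Import Defs.
From HB Require Import structures.
From mathcomp Require Import all_boot all_order all_algebra.
From mathcomp Require Import boolp classical_sets functions reals.
From mathcomp Require Import ring.
Import GRing.Theory.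
Set Implicit Arguments.
Unset Strict Implicit.

(** For cocycles [alpha], [beta], the function [c x y = Tr (alpha x^-1) (beta y)]
    is a 2-cocycle on [Gamma]; let [E] be the central extension of [Gamma] by [R]
    that it defines.  By the Fox product rule, the relator [r] evaluated in [E] at
    the lifts [(s, 0)] of the generators is [(1, - <alpha cup beta, [Sigma]>)].
    The commutators in [r] do not depend on the lifts of the [x_i], [y_i], and
    replacing [(z_j, 0)] by [(z_j, Tr (X_j beta(z_j)))] turns the value into
    [(1, - omega)].  These special lifts of parabolic elements are unique, stable
    under inversion and equivariant under conjugation, so [- omega] is a relator
    value computed in a group.  It is therefore unchanged by a change of
    presentation of the same orientation (the new relator is a product of
    conjugates of the central element [r^(+-1)] of total exponent 1) and by
    gluing, because
    [z_1 ... z_b z+ z- = [c z+ c^-1, c t^-1 c^-1] z_1 ... z_b] with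
    [c = z_1 ... z_b] and [z- = t^-1 z+^-1 t] is an identity valid in every
    group, hence in [E].  Changing [alpha] or [beta] by a coboundary gives an
    isomorphic extension, by an isomorphism that preserves the special lifts. *)

(** * Values of words in a group and homomorphisms *)

Section Words.
Local Open Scope group_scope.
Context {I : Type} {G : groupType}.
Implicit Types (f : I -> G) (w u v : word I).

Lemma weval_nil f : weval f [::] = 1.
Proof. by rewrite /weval big_nil. Qed.

Lemma weval_cons f l w :
  weval f (l :: w) = (if l.2 then (f l.1)^-1 else f l.1) * weval f w.
Proof. by rewrite /weval big_cons. Qed.

Lemma weval_cat f u v : weval f (u ++ v) = weval f u * weval f v.
Proof. by rewrite /weval big_cat. Qed.

Lemma weval_letter f (s : I) : weval f [:: (s, false)] = f s.
Proof. by rewrite weval_cons weval_nil mulg1. Qed.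

Lemma weval_inv f w : weval f (winv w) = (weval f w)^-1.
Proof.
elim: w => [|l w IH]; first by rewrite /winv /= !weval_nil invg1.
rewrite /winv /= rev_cons -cats1 weval_cat -/(winv w) IH.
rewrite !weval_cons weval_nil mulg1 invgM.
by congr (_ * _); case: l => s []; rewrite //= invgK.
Qed.

Lemma weval_comm f u v :
  weval f (wcomm u v)
  = weval f u * weval f v * (weval f u)^-1 * (weval f v)^-1.
Proof. by rewrite !weval_cat !weval_inv !mulgA. Qed.

Lemma weval_conj f u v :
  weval f (wconj u v) = weval f u * weval f v * (weval f u)^-1.
Proof. by rewrite !weval_cat weval_inv !mulgA. Qed.

Lemma weval_flatten f (J : Type) (h : J -> word I) (s : seq J) :
  weval f (flatten [seq h j | j <- s]) = \prod_(j <- s) weval f (h j).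
Proof.
elim: s => [|j s IH]; first by rewrite /= weval_nil big_nil.
by rewrite /= weval_cat IH big_cons.
Qed.

Lemma weval_subst f (J : Type) (w : J -> word I) (v : word J) :
  weval f (wsubst w v) = weval (fun j => weval f (w j)) v.
Proof.
rewrite /wsubst weval_flatten; apply: eq_bigr => -[s []] _ //=.
exact: weval_inv.
Qed.

Lemma eq_weval f f' w : f =1 f' -> weval f w = weval f' w.
Proof. by move=> eqf; apply: eq_bigr => l _; rewrite eqf. Qed.

End Words.

Section Homomorphisms.
Local Open Scope group_scope.

Lemma hom1 (G H : groupType) (f : G -> H) : is_hom f -> f 1 = 1.
Proof. by move=> fM; apply: (mulgI (f 1)); rewrite -fM !mulg1. Qed.

Lemma homV (G H : groupType) (f : G -> H) :
  is_hom f -> forall x, f x^-1 = (f x)^-1.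
Proof. by move=> fM x; apply/esym/mulg1_eq; rewrite -fM mulgV hom1. Qed.

Lemma weval_hom (I : Type) (G H : groupType) (phi : G -> H) (f : I -> G)
    (w : word I) :
  is_hom phi -> phi (weval f w) = weval (phi \o f) w.
Proof.
move=> phiM.
elim: w => [|l w IH]; first by rewrite !weval_nil (hom1 phiM).
by rewrite !weval_cons phiM IH; case: l => s []; rewrite //= (homV phiM).
Qed.

End Homomorphisms.

(** * The surface relator under gluing and under central changes of generators *)

Section SurfaceRelator.
Local Open Scope group_scope.

Lemma weval_surf_rel (g b : nat) (G : groupType) (f : gen g b -> G) :
  weval f (surf_rel g b) =
  \prod_(i < g) (f (gX b i) * f (gY b i) * (f (gX b i))^-1 * (f (gY b i))^-1)
  * \prod_(j < b) f (gZ g j).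
Proof.
rewrite /surf_rel weval_cat weval_flatten !enumT [index_enum _]unlock
  [index_enum _]unlock; congr (_ * _).
  by apply: eq_bigr => i _; rewrite weval_comm !weval_letter.
by rewrite /weval big_map.
Qed.

(* [c z+ c^-1, c t^-1 c^-1] c = c z+ t^-1 z+^-1 t, and c = z_1 ... z_b. *)
Lemma weval_glued (g b : nat) (G : groupType) (f : gen g (b + 2) -> G) (t : G) :
  f zminus = (f zplus)^-1 ^ t ->
  weval (glued_presentation id f t) (surf_rel g.+1 b)
  = weval f (surf_rel g (b + 2)).
Proof.
move=> fm; rewrite !weval_surf_rel big_ord_recr /= -mulgA; congr (_ * _).
  apply: eq_bigr => i _; rewrite /glued_presentation /=.
  have -> : widen_ord (leqnSn g) i = lift ord_max i.
    by apply: val_inj; rewrite /= /bump leqNgt ltn_ord.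
  by rewrite liftK.
rewrite unlift_none big_split_ord /= !big_ord_recl big_ord0 mulg1.
set c := \prod_(j < b) _.
rewrite -/zplus (_ : rshift b _ = rshift b ord_max); last first.
  by congr rshift; apply: val_inj.
rewrite -/zminus fm !invgM !invgK conjgE !mulgA.
by rewrite !mulgVK.
Qed.

End SurfaceRelator.

Section CentralShift.
Local Open Scope group_scope.

Lemma conjg_mul_central (G : groupType) (v x y : G) :
  (forall z, commute v z) -> x * v * y * (x * v)^-1 = x * y * x^-1.
Proof. by move=> vC; rewrite invgM !mulgA -(mulgA x) vC !mulgA mulgK. Qed.

(** Central factors cancel in every commutator, so only those of the boundary generators survive. *)
Lemma weval_surf_rel_central (g b : nat) (G : groupType) (f v : gen g b -> G) :
  (forall s x, commute (v s) x) ->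
  weval (fun s => f s * v s) (surf_rel g b)
  = weval f (surf_rel g b) * \prod_(j < b) v (gZ g j).
Proof.
move=> vC; rewrite !weval_surf_rel.
have vK s t : f s * v s * (f t * v t) * (f s * v s)^-1 * (f t * v t)^-1
    = f s * f t * (f s)^-1 * (f t)^-1.
  by rewrite conjg_mul_central // -!(mulgA (f s)) conjg_mul_central.
rewrite (eq_bigr _ (fun i _ => vK _ _)) -mulgA; congr (_ * _).
apply: prodgM_commute => i j _ _.
exact/commute_sym/vC.
Qed.

End CentralShift.

(** * Central extensions defined by normalized 2-cocycles *)

Section CentralExtension.
Local Open Scope ring_scope.

Definition two_cocycle (G : groupType) (V : zmodType) (c : G -> G -> V) :=
  [/\ forall x, c 1%g x = 0, forall x, c x 1%g = 0
    & forall x y z, c x y + c (x * y)%g z = c y z + c x (y * z)%g].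

(** The proof of the cocycle condition is an argument of the type, so that the group structure built
    from it can be inferred. *)
Definition cext (G : groupType) (V : zmodType) (c : G -> G -> V)
  (_ : two_cocycle c) : Type := (G * V)%type.

Context {G : groupType} {V : zmodType} {c : G -> G -> V}.
Context (hc : two_cocycle c).
Local Notation E := (cext hc).
Implicit Types a b d : E.

HB.instance Definition _ := Choice.copy E (G * V)%type.

Definition cext_one : E := (1%g, 0).
Definition cext_mul a b : E := ((a.1 * b.1)%g, a.2 + b.2 + c a.1 b.1).
Definition cext_inv a : E := ((a.1^-1)%g, - a.2 - c (a.1^-1)%g a.1).

Fact cext_mulA : associative cext_mul.
Proof.
have [_ _ h] := hc; move=> [x a] [y b] [z d].
rewrite /cext_mul /= mulgA; congr (_, _).
rewrite !addrA -(addrA _ (c y z)) -h addrA.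
by rewrite (addrAC (a + b) (c x y) d).
Qed.
Fact cext_mul1 : left_id cext_one cext_mul.
Proof.
by have [h _ _] := hc; move=> [x a]; rewrite /cext_mul /= mul1g h addr0 add0r.
Qed.
Fact cext_mulr1 : right_id cext_one cext_mul.
Proof.
by have [_ h _] := hc; move=> [x a]; rewrite /cext_mul /= mulg1 h !addr0.
Qed.
Fact cext_mulV : left_inverse cext_one cext_inv cext_mul.
Proof.
by move=> [x a]; rewrite /cext_mul /= mulVg addrAC subrK addNr.
Qed.
Fact cext_mulrV : right_inverse cext_one cext_inv cext_mul.
Proof.
have [h1 h2 h] := hc; move=> [x a]; rewrite /cext_mul /= mulgV addrA subrr add0r.
(* The cocycle identity at x, x^-1, x gives c(x, x^-1) = c(x^-1, x). *)
have := h x x^-1%g x; rewrite mulgV mulVg h1 h2 !addr0 => ->.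
by rewrite addNr.
Qed.

HB.instance Definition _ := isGroup.Build E
  cext_mulA cext_mul1 cext_mulr1 cext_mulV cext_mulrV.

Definition ccen (v : V) : E := (1%g, v).

Lemma cext_mulE a b : (a * b)%g = ((a.1 * b.1)%g, a.2 + b.2 + c a.1 b.1).
Proof. by []. Qed.

Lemma fst_cext : is_hom (fun a : E => a.1).
Proof. by []. Qed.

Lemma mul_ccen a v : (a * ccen v)%g = (a.1, a.2 + v).
Proof. by have [_ h _] := hc; rewrite cext_mulE /= mulg1 h addr0. Qed.

Lemma ccen_central v a : commute (ccen v) a.
Proof.
rewrite /commute mul_ccen; have [h _ _] := hc.
by rewrite cext_mulE /= mul1g h addr0 addrC.
Qed.

Lemma ccenD u v : ccen (u + v) = (ccen u * ccen v)%g.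
Proof. by rewrite mul_ccen. Qed.

Lemma ccenN v : ccen (- v) = (ccen v)^-1%g.
Proof. by apply/esym/mulg1_eq; rewrite -ccenD subrr. Qed.

Lemma ccen_sum (J : Type) (r : seq J) (F : J -> V) :
  (\prod_(j <- r) ccen (F j))%g = ccen (\sum_(j <- r) F j).
Proof. by apply/esym/(big_morph ccen) => // u v; exact: ccenD. Qed.

(** Two elements over the same point differ by a central one, so conjugation in the extension
    factors through [G]. *)
Lemma cext_conj_fiber a a' b :
  a.1 = a'.1 -> (a * b * a^-1)%g = (a' * b * a'^-1)%g.
Proof.
move=> e; have -> : a = (a' * ccen (a.2 - a'.2))%g.
  by rewrite mul_ccen addrC subrK -e; case: a {e}.
exact/conjg_mul_central/ccen_central.
Qed.

End CentralExtension.

(** * The adjoint action and the invariance of the trace form *)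

Section Adjoint.
Local Open Scope ring_scope.
Local Open Scope quotient_scope.
Context {F : fieldType} {n : nat}.
Implicit Types (a b : PSL F n) (X Y : 'M[F]_n).

Lemma Ad_pi (A : SL F n) X :
  Ad (\pi_(PSL F n) A) X = slval A *m X *m invmx (slval A).
Proof.
have [k eA] := psl_reprP A.
apply: (canRL (mulmxK (sl_unit A))).
by rewrite {1}eA /Ad -scalemxAr mulmxKV ?sl_unit // eA scalemxAl.
Qed.

Lemma AdM a b X : Ad (a * b)%g X = Ad a (Ad b X).
Proof.
rewrite (_ : (a * b)%g = \pi_(PSL F n) (repr a * repr b)%g) // Ad_pi.
by rewrite -slvalV invgM !slvalM !slvalV /Ad !mulmxA.
Qed.

Lemma Ad1 X : Ad (1%g : PSL F n) X = X.
Proof.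
by rewrite (_ : 1%g = \pi_(PSL F n) 1%g) // Ad_pi invmx1 mulmx1 mul1mx.
Qed.

Lemma AdK a X : Ad (a^-1)%g (Ad a X) = X.
Proof. by rewrite -AdM mulVg Ad1. Qed.

Fact Ad_zmod_morphism a : {morph Ad a : X Y / X - Y}.
Proof. by move=> X Y; rewrite /Ad mulmxBr mulmxBl. Qed.
HB.instance Definition _ a :=
  GRing.isZmodMorphism.Build 'M[F]_n 'M[F]_n (Ad a) (Ad_zmod_morphism a).

Lemma mxtrace_Ad a X : \tr (Ad a X) = \tr X.
Proof. by rewrite /Ad mxtrace_mulC mulmxA mulVmx ?sl_unit // mul1mx. Qed.

Lemma Ad_mulmx a X Y : Ad a (X *m Y) = Ad a X *m Ad a Y.
Proof. by rewrite /Ad !mulmxA mulmxKV ?sl_unit. Qed.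

Lemma mxtrace_Adl a X Y : \tr (Ad a X *m Y) = \tr (X *m Ad (a^-1)%g Y).
Proof. by rewrite -(mxtrace_Ad (a^-1)%g) Ad_mulmx AdK. Qed.

Lemma mxtrace_Adr a X Y : \tr (X *m Ad a Y) = \tr (Ad (a^-1)%g X *m Y).
Proof. by rewrite mxtrace_Adl invgK. Qed.

End Adjoint.

(** * Cocycles, coboundaries and parabolic elements *)

Section Cocycles.
Local Open Scope ring_scope.
Context {R : realType} {n : nat} {Gam : groupType} {rho : Gam -> PSL R n}.
Implicit Types (alpha beta : Gam -> 'M[R]_n) (x y z : Gam).

Context (rhoM : is_hom rho).

Section OneCocycle.
Context {alpha} (alphaZ : cocycle rho alpha).

Lemma cocycleM x y : alpha (x * y)%g = alpha x + Ad (rho x) (alpha y).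
Proof. by case: alphaZ. Qed.

Lemma cocycle1 : alpha 1%g = 0.
Proof.
have := cocycleM 1%g 1%g; rewrite mulg1 (hom1 rhoM) Ad1.
by rewrite -{1}[alpha _]addr0 => /addrI.
Qed.

Lemma cocycleV x : alpha x^-1%g = - Ad (rho x)^-1%g (alpha x).
Proof.
apply/eqP; rewrite -addr_eq0 -(homV rhoM).
by rewrite -cocycleM mulVg cocycle1.
Qed.

Lemma cocycle_VM x y :
  alpha (x * y)^-1%g = alpha y^-1%g + Ad (rho y)^-1%g (alpha x^-1%g).
Proof. by rewrite invgM cocycleM (homV rhoM). Qed.
End OneCocycle.

(** On cocycles this is minus the usual cup product Tr (alpha(x) Ad_x beta(y)), since alpha(x^-1) =
    - Ad_{x^-1} alpha(x). *)
Definition cup (alpha beta : Gam -> 'M[R]_n) (x y : Gam) : R :=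
  \tr (alpha x^-1%g *m beta y).

Lemma cup_two_cocycle alpha beta :
  cocycle rho alpha -> cocycle rho beta -> two_cocycle (cup alpha beta).
Proof.
move=> hA hB; rewrite /cup; split=> [x|x|x y z].
- by rewrite invg1 cocycle1 // mul0mx mxtrace0.
- by rewrite [beta _]cocycle1 // mulmx0 mxtrace0.
rewrite cocycle_VM // (cocycleM hB) mulmxDl mulmxDr !mxtraceD.
by rewrite mxtrace_Adl invgK addrCA addrA -addrA addrCA.
Qed.

(** Cocycles that agree at z agree on the cyclic subgroup of z, so the condition can be tested at z
    alone. *)
Definition parabolic alpha z :=
  exists2 X, sl X & alpha z = coboundary rho X z.

Lemma coboundaryB X Y z :
  coboundary rho (X - Y) z = coboundary rho X z - coboundary rho Y z.
Proof. by rewrite /coboundary raddfB /= !opprD addrACA. Qed.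

Lemma sl0 : sl (0 : 'M[R]_n).
Proof. exact: mxtrace0. Qed.

Lemma slD (X Y : 'M[R]_n) : sl X -> sl Y -> sl (X + Y).
Proof. by rewrite /sl /= mxtraceD => -> ->; rewrite addr0. Qed.

Lemma slN (X : 'M[R]_n) : sl X -> sl (- X).
Proof. by rewrite /sl /= raddfN /= => ->; rewrite oppr0. Qed.

Lemma sl_Ad a (X : 'M[R]_n) : sl X -> sl (Ad a X).
Proof. by rewrite /sl /= mxtrace_Ad. Qed.

Lemma sl_coboundary X z : sl X -> sl (coboundary rho X z).
Proof. by move=> sX; apply: slD; [exact: sl_Ad|exact: slN]. Qed.

Lemma coboundary_cocycle X : sl X -> cocycle rho (coboundary rho X).
Proof.
move=> sX; split=> [z|x y]; first exact: sl_coboundary.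
by rewrite /coboundary rhoM AdM raddfB /= [RHS]addrC subrKA.
Qed.

Lemma cocycleD alpha beta :
  cocycle rho alpha -> cocycle rho beta ->
  cocycle rho (fun x => alpha x + beta x).
Proof.
move=> [sA hA] [sB hB]; split=> [x|x y]; first exact: slD.
by rewrite hA hB raddfD /= addrACA.
Qed.

Lemma parabolicD alpha beta z :
  parabolic alpha z -> parabolic beta z ->
  parabolic (fun x => alpha x + beta x) z.
Proof.
move=> [X sX eX] [Y sY eY]; exists (X + Y); first exact: slD.
by rewrite eX eY /coboundary raddfD /= opprD addrACA.
Qed.

Lemma coboundary_inv alpha z X :
  cocycle rho alpha -> alpha z = coboundary rho X z ->
  alpha z^-1%g = coboundary rho X z^-1%g.
Proof.
move=> hA eX.
by rewrite (cocycleV hA) eX /coboundary raddfB /= AdK opprB homV.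
Qed.

Lemma parabolicV alpha z :
  cocycle rho alpha -> parabolic alpha z -> parabolic alpha z^-1%g.
Proof.
move=> hA [X sX eX]; exists X => //.
exact: coboundary_inv.
Qed.

(** The cocycle gamma = alpha - dX vanishes at z, so its value at u z u^-1 is that of the coboundary
    of - gamma(u). Hence X is replaced by X - gamma(u) = Ad_u X - alpha(u). *)
Lemma coboundary_conj alpha u z X :
  cocycle rho alpha -> alpha z = coboundary rho X z ->
  alpha (u * z * u^-1)%g
  = coboundary rho (Ad (rho u) X - alpha u) (u * z * u^-1)%g.
Proof.
move=> hA eX; rewrite coboundaryB !(cocycleM hA) (cocycleV hA) raddfN /=.
rewrite /coboundary !rhoM homV // !AdM AdK eX /coboundary raddfB /=.
by rewrite opprB [RHS]addrC addrAC.
Qed.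

Lemma parabolicJ alpha u z :
  cocycle rho alpha -> parabolic alpha z -> parabolic alpha (u * z * u^-1)%g.
Proof.
move=> hA [X sX eX]; exists (Ad (rho u) X - alpha u).
  by apply: slD; [exact: sl_Ad|apply: slN; case: hA].
exact: coboundary_conj.
Qed.

(** * The cup product extension and the special lifts of parabolic elements *)

Section Extension.
Context {alpha beta} (alphaZ : cocycle rho alpha) (betaZ : cocycle rho beta).
Local Notation E := (cext (cup_two_cocycle alphaZ betaZ)).
Implicit Types a : E.

(** On a subgroup where alpha = dX, the map x -> (x, Tr (X beta(x))) is a homomorphism into [E]; the
    special lifts are its values. *)
Definition plift a :=
  exists X, [/\ sl X, alpha a.1 = coboundary rho X a.1
    & a.2 = \tr (X *m beta a.1)].

Lemma pliftV a : plift a -> plift a^-1%g.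
Proof.
case: a => z v [X [/= sX eX ->]]; exists X; split=> //=.
  exact: coboundary_inv.
rewrite (cocycleV betaZ) mulmxN raddfN /= /cup invgK eX mulmxBl raddfB /=.
by rewrite mxtrace_Adl opprB addKr.
Qed.

Lemma pliftJ a b : plift b -> plift (a * b * a^-1)%g.
Proof.
(* Only the first component of the conjugating element matters, so the second one may be taken to be
   0. *)
have -> : (a * b * a^-1)%g = (((a.1, 0) : E) * b * ((a.1, 0) : E)^-1)%g.
  exact: cext_conj_fiber.
case: a b => [u _] [z v] [X [/= sX eX ->]].
exists (Ad (rho u) X - alpha u); split.
- by apply: slD; [exact: sl_Ad|apply: slN; case: alphaZ].
- exact: coboundary_conj.
rewrite /= /cup invgK (cocycle_VM _ u z) // !(cocycleV _ u) // (cocycleV _ z) //.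
rewrite eX /coboundary !(cocycleM betaZ) (cocycleV _ u) // !rhoM.
have trN (Y : 'M[R]_n) : \tr (- Y) = - \tr Y by rewrite raddfN.
have AdN (a : PSL R n) (Y : 'M[R]_n) : Ad a (- Y) = - Ad a Y by rewrite raddfN.
have AdB (a : PSL R n) (Y Z : 'M[R]_n) : Ad a (Y - Z) = Ad a Y - Ad a Z.
  by rewrite raddfB.
(* Every [Ad] is moved to the first factor of its trace, where inverse pairs cancel; an identity
   between real numbers remains. *)
rewrite !AdM !(mulmxDl, mulmxDr, mulNmx, mulmxN, mxtraceD, trN) !mxtrace_Adr.
rewrite !(AdB, AdN) !AdK !(mulmxDl, mulNmx, mulmxN, mxtraceD, trN).
rewrite !mxtrace_Adr !invgK.
ring.
Qed.

(** Two choices of X differ by a matrix fixed by Ad_z, and such a matrix is orthogonal to beta(z) =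
    Ad_z Z - Z for the trace form. *)
Lemma plift_inj a b :
  plift a -> plift b -> a.1 = b.1 -> parabolic beta a.1 -> a = b.
Proof.
case: a b => [z v] [y w] [X [/= _ eX ->]] [Y [/= _ eY ->]] e.
rewrite -{}e in eY *; case=> Z _ ->; congr (_, _).
apply/eqP; rewrite -subr_eq0 -raddfB /= -mulmxBl.
have : coboundary rho (X - Y) z = 0 by rewrite coboundaryB -eX -eY subrr.
move/eqP; rewrite subr_eq0 => /eqP fixXY.
by rewrite mulmxBr raddfB /= mxtrace_Adr -{1}fixXY AdK subrr.
Qed.

(** * Fox calculus in the extension *)

Section FoxFormula.
Context {I : finType} (p : I -> Gam).

Lemma big_fox_cons (V : nmodType) (h : I -> int * word I -> V) l (w : word I) :
  \sum_s \sum_(c <- fox s (l :: w)) h s c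
  = h l.1 (if l.2 then (-1, [:: l]) else (1, [::]))
    + \sum_s \sum_(c <- fox s w) h s (c.1, l :: c.2).
Proof.
under eq_bigr => s _ do rewrite /= big_cat big_map.
rewrite big_split /=; congr (_ + _).
rewrite (bigD1 l.1) //= eqxx big_seq1 big1 ?addr0 // => s ns.
by rewrite eq_sym (negbTE ns) big_nil.
Qed.

(** The fundamental formula w - 1 = sum_s (dw/ds)(s - 1) of Fox calculus, seen through the cocycle
    beta. *)
Lemma fox_fundamental (w : word I) :
  \sum_s \sum_(c <- fox s w) Ad (rho (weval p c.2)) (beta (p s)) *~ c.1
  = beta (weval p w).
Proof.
elim: w => [|l w IH].
  by rewrite big1 ?weval_nil ?cocycle1 // => s _; rewrite big_nil.
rewrite big_fox_cons weval_cons (cocycleM betaZ) -{}IH; congr (_ + _).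
  case: l => s [] /=; rewrite ?weval_cons weval_nil ?mulg1 ?mulr1z /=.
    by rewrite cocycleV // homV // mulrNz mulr1z.
  by rewrite hom1 // Ad1.
rewrite raddf_sum; apply: eq_bigr => s _; rewrite raddf_sum.
apply: eq_bigr => c _ /=; rewrite weval_cons rhoM AdM.
by rewrite raddfMz.
Qed.

(** Multiplying v by a letter l adds the term [cup] of l and v. Expanding beta(v) by the fundamental
    formula turns it into the change of alpha on dv/ds when l is prefixed. *)
Lemma weval_fox (w : word I) :
  weval (fun s => (p s, 0) : E) w
  = (weval p w,
     \sum_s \tr ((\sum_(c <- fox s w) alpha (weval p c.2)^-1%g *~ c.1)
                 *m beta (p s))).
Proof.
pose h s (c : int * word I) :=
  \tr (alpha (weval p c.2)^-1%g *m beta (p s)) *~ c.1.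
have trE u : \sum_s \tr ((\sum_(c <- fox s u) alpha (weval p c.2)^-1%g *~ c.1)
   *m beta (p s)) = \sum_s \sum_(c <- fox s u) h s c.
  apply: eq_bigr => s _; rewrite mulmx_suml raddf_sum; apply: eq_bigr => c _.
  by rewrite /h -raddfMz -(raddfMz (mulmxr _)).
rewrite trE; elim: w => [|l w IH].
  by rewrite !weval_nil big1 // => s _; rewrite big_nil.
rewrite big_fox_cons !weval_cons {}IH.
set a := (if l.2 then _ else _ : E).
set x := (if l.2 then _ else _ : Gam).
have ea : a.1 = x by rewrite /a /x; case: l.2.
(* A letter s contributes Tr (alpha(1) beta(s)) = 0. A letter s^-1 contributes - Tr (alpha(s)
   beta(s)), the second component of the inverse of (s, 0). *)
have -> : h l.1 (if l.2 then (-1, [:: l]) else (1, [::])) = a.2.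
  rewrite /h /a; case: l {a x ea} => s [] /=; last first.
    by rewrite weval_nil invg1 cocycle1 // mul0mx mxtrace0 mul0rz.
  by rewrite weval_cons weval_nil mulg1 mulrNz mulr1z /cup /= oppr0 add0r.
rewrite cext_mulE {}ea -addrA; congr (_, _ + _).
rewrite /cup -fox_fundamental mulmx_sumr raddf_sum -big_split /=.
apply: eq_bigr => s _; rewrite mulmx_sumr raddf_sum -big_split /=.
apply: eq_bigr => c _; rewrite /h weval_cons /= -/x cocycle_VM // mulmxDl.
by rewrite mxtraceD mulrzDl mxtrace_Adl invgK (raddfMz (mulmx _)) raddfMz.
Qed.
End FoxFormula.

End Extension.

End Cocycles.

(** * The pairing as a relator value *)

Section Omega.
Local Open Scope ring_scope.
Context {R : realType} {n : nat} {Gam : groupType} {rho : Gam -> PSL R n}.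
Context (rhoM : is_hom rho).

Section Lifts.
Context {alpha beta : Gam -> 'M[R]_n}.
Context (alphaZ : cocycle rho alpha) (betaZ : cocycle rho beta).
Local Notation E := (cext (cup_two_cocycle rhoM alphaZ betaZ)).
Local Notation plift := (@plift R n Gam rho rhoM alpha beta alphaZ betaZ).

(** Where alpha is not parabolic, [xget] returns 0 and the lift is (p s, 0). *)
Lemma exists_plift (I : Type) (p : I -> Gam) :
  exists f : I -> E, (forall s, (f s).1 = p s) /\
    forall s, parabolic (rho := rho) alpha (p s) -> plift (f s).
Proof.
pose X s := xget 0 [set X | sl X /\ alpha (p s) = coboundary rho X (p s)]%classic.
exists (fun s => (p s, \tr (X s *m beta (p s)))); split=> // s [Y sY eY].
have [sX eX] :
  [set X | sl X /\ alpha (p s) = coboundary rho X (p s)]%classic (X s).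
  exact: xgetPex (ex_intro _ Y (conj sY eY)).
by exists (X s).
Qed.

Lemma weval_plift (g b : nat) (f : gen g b -> E) :
  (forall j, plift (f (gZ g j))) ->
  (forall j, parabolic (rho := rho) beta (f (gZ g j)).1) ->
  weval f (surf_rel g b)
  = (weval (fun s => (f s).1) (surf_rel g b),
     - omega_cocycle (fun s => (f s).1) rho alpha beta).
Proof.
move=> fP bP; pose p s := (f s).1; rewrite -/p.
have fE s : f s = (((p s, 0) : E) * ccen _ (f s).2)%g.
  by rewrite mul_ccen /= add0r /p; case: (f s).
rewrite (eq_weval _ fE) weval_surf_rel_central; last first.
  by move=> s x; exact: ccen_central.
rewrite weval_fox ccen_sum mul_ccen /=; congr (_, _).
rewrite /omega_cocycle /cup_fund opprB opprK addrC; congr (_ + _).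
apply: eq_bigr => j _.
(* The matrix picked by [omega_cocycle] may differ from the witness of [plift]; uniqueness of
   special lifts equates the two traces. *)
set X := xget _ _; have [Y [sY eY _]] := fP j.
have [sX eX] : [set X | sl X /\
    alpha (p (gZ g j)) = coboundary rho X (p (gZ g j))]%classic X.
  exact: xgetPex (ex_intro _ Y (conj sY eY)).
have pX : plift ((p (gZ g j), \tr (X *m beta (p (gZ g j)))) : E) by exists X.
by rewrite (plift_inj (fP j) pX erefl (bP j)).
Qed.

Lemma omega_weval (g b : nat) (f : gen g b -> E) (v : R) :
  (forall j, plift (f (gZ g j))) ->
  (forall j, parabolic (rho := rho) beta (f (gZ g j)).1) ->
  weval f (surf_rel g b) = ccen _ v ->
  omega_cocycle (fun s => (f s).1) rho alpha beta = - v.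
Proof. by move=> fP bP; rewrite weval_plift // => -[_ <-]; rewrite opprK. Qed.

Lemma omega_same_orientation (g b : nat) (p q : gen g b -> Gam) :
  weval p (surf_rel g b) = 1%g ->
  (forall j, parabolic (rho := rho) alpha (p (gZ g j))) ->
  (forall j, parabolic (rho := rho) beta (p (gZ g j))) ->
  same_orientation p q ->
  omega_cocycle q rho alpha beta = omega_cocycle p rho alpha beta.
Proof.
move=> prel aP bP [w [u [e [wq wz rel_e sum_e]]]].
have [f [fp fP]] := exists_plift p.
(* The words that express q in p, evaluated at lifts of p, give lifts of q that are special on the
   boundary. *)
pose f' s := weval f (w s).
have f'q s : (f' s).1 = q s.
  rewrite /f' (weval_hom f (w s) (fst_cext (hc := _))) -wq.
  by apply: eq_weval => t /=.
have f'z j : f' (gZ g j) = (weval f (u j) * f (gZ g j) * (weval f (u j))^-1)%g.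
  by rewrite /f' wz weval_conj weval_letter.
have -> : q = fun s => (f' s).1 by apply/funext => s; rewrite f'q.
rewrite -[RHS]opprK; apply: (omega_weval (f := f')).
- by move=> j; rewrite f'z; apply/pliftJ/fP.
- by move=> j; rewrite f'z /=; apply: parabolicJ => //; rewrite fp.
have frel : weval f (surf_rel g b) = ccen _ (- omega_cocycle p rho alpha beta).
  have fpE : (fun s => (f s).1) = p by apply/funext.
  rewrite weval_plift ?fpE ?prel // => j; first exact: fP.
  by rewrite fp.
(* The equality of words holds in every group, in particular in [E]. *)
rewrite -weval_subst rel_e // weval_flatten.
set v := - _.
have -> : v = v *~ (\sum_(c <- e) (-1) ^+ c.1) by rewrite sum_e mulr1z.
rewrite mulrz_sumr -ccen_sum.
apply: eq_bigr => -[[] x] _ /=; rewrite weval_conj ?weval_inv frel -/v.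
  by rewrite -ccenN -ccen_central mulgK mulrNz mulr1z.
by rewrite -ccen_central mulgK mulr1z.
Qed.

Lemma omega_glued (g b : nat) (p : gen g (b + 2) -> Gam) (t : Gam) :
  p zminus = ((p zplus)^-1 ^ t)%g ->
  weval p (surf_rel g (b + 2)) = 1%g ->
  (forall j, parabolic (rho := rho) alpha (p (gZ g j))) ->
  (forall j, parabolic (rho := rho) beta (p (gZ g j))) ->
  omega_cocycle (glued_presentation id p t) rho alpha beta
  = omega_cocycle p rho alpha beta.
Proof.
move=> pm prel aP bP.
have [f0 [f0p f0P]] := exists_plift p.
pose T : E := (t, 0).
(* The lift of z- is chosen so that the gluing relation holds in [E] itself; inversion and
   conjugation keep it special. *)
pose f s := if s == zminus then ((f0 zplus)^-1 ^ T)%g else f0 s.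
have fp : (fun s => (f s).1) = p.
  apply/funext => s; rewrite /f; case: eqP => [->|//].
  by rewrite pm -f0p.
have fP j : plift (f (gZ g j)).
  rewrite /f; case: eqP => _; last exact: f0P.
  rewrite conjgE mulgA -{2}[T]invgK; apply/pliftJ/pliftV/f0P; exact: aP.
have fbP j : parabolic (rho := rho) beta (f (gZ g j)).1.
  by rewrite (_ : (f _).1 = p (gZ g j)) // -fp.
have fm : f zminus = ((f zplus)^-1 ^ T)%g.
  by rewrite /f eqxx ifN //; apply/eqP => -[/eqP]; rewrite eqn_add2l. 
pose f1 := glued_presentation id f T.
have fp1 s : (f s).1 = p s by rewrite -fp.
have f1p : (fun s => (f1 s).1) = glued_presentation id p t.
  have fstprod : (\prod_(j < b) f (gZ g (lshift 2 j)))%g.1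
      = (\prod_(j < b) p (gZ g (lshift 2 j)))%g.
    by under [RHS]eq_bigr do rewrite -fp1; exact: (big_morph (fun a : E => a.1)).
  apply/funext => -[[i|i]|j]; rewrite /f1 /glued_presentation //.
  - by case: unlift => [k|] /=; rewrite fp1 // fstprod.
  - by case: unlift => [k|] /=; rewrite ?fp1 // fstprod.
apply: oppr_inj; rewrite -f1p -fp.
(* The relator identity is applied in [E], and second components are compared. *)
have := weval_glued fm; rewrite -/f1 !weval_plift //.
  by case.
- move=> j; exact: fP.
- move=> j; exact: fbP.
Qed.
End Lifts.

(** * Invariance of the pairing under coboundaries *)

Section Coboundary.

(* An isomorphism of central extensions [(x, v) -> (x, v + phi x)] that respects
   the lifts of parabolic elements. *)
Lemma omega_iso (alpha beta alpha' beta' : Gam -> 'M[R]_n) (phi : Gam -> R)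
    (g b : nat) (p : gen g b -> Gam) :
  cocycle rho alpha -> cocycle rho beta ->
  cocycle rho alpha' -> cocycle rho beta' ->
  (forall x y, cup alpha' beta' x y
    = cup alpha beta x y + phi (x * y)%g - phi x - phi y) ->
  (forall z X, sl X -> alpha z = coboundary rho X z ->
    exists X', [/\ sl X', alpha' z = coboundary rho X' z
      & \tr (X' *m beta' z) = \tr (X *m beta z) + phi z]) ->
  weval p (surf_rel g b) = 1%g ->
  (forall j, parabolic (rho := rho) alpha (p (gZ g j))) ->
  (forall j, parabolic (rho := rho) beta (p (gZ g j))) ->
  (forall j, parabolic (rho := rho) beta' (p (gZ g j))) ->
  omega_cocycle p rho alpha' beta' = omega_cocycle p rho alpha beta.
Proof.
move=> aZ bZ aZ' bZ' cupE liftE prel aP bP bP'.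
pose Phi (a : cext (cup_two_cocycle rhoM aZ bZ)) :
  cext (cup_two_cocycle rhoM aZ' bZ') := (a.1, a.2 + phi a.1).
have PhiM : is_hom Phi.
  move=> [x v] [y w]; rewrite /Phi !cext_mulE /= cupE; congr (_, _).
  ring.
(* Both cup products vanish at (1, 1), which forces phi(1) = 0; so [Phi] maps each central (1, v) to
   (1, v). *)
have phi1 : phi 1%g = 0.
  have [h _ _] := cup_two_cocycle rhoM aZ bZ.
  have [h' _ _] := cup_two_cocycle rhoM aZ' bZ'.
  have := cupE 1%g 1%g; rewrite h h' mulg1 add0r subrr add0r.
  by move/esym/eqP; rewrite oppr_eq0 => /eqP.
have [f [fp fP]] := exists_plift aZ bZ p.
have fpE : (fun s => (f s).1) = p by apply/funext.
pose f' := Phi \o f.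
have fpE' : (fun s => (f' s).1) = p by rewrite -fpE.
have frel : weval f (surf_rel g b) = ccen _ (- omega_cocycle p rho alpha beta).
  by rewrite weval_plift ?fpE ?prel // => j; [exact: fP|rewrite fp].
rewrite -{1}fpE' -[RHS]opprK; apply: omega_weval.
- move=> j; have [X [sX eX vX]] := fP _ (aP j).
  have [X' [sX' eX' vX']] := liftE _ _ sX eX.
  by exists X'; split=> //=; rewrite vX vX'.
- by move=> j; rewrite (_ : (f' _).1 = p (gZ g j)) // -fpE'.
by rewrite -weval_hom // frel /Phi /= phi1 addr0.
Qed.

Lemma omega_coboundaryl (alpha beta : Gam -> 'M[R]_n) (Y : 'M[R]_n)
    (g b : nat) (p : gen g b -> Gam) :
  cocycle rho alpha -> cocycle rho beta -> sl Y ->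
  weval p (surf_rel g b) = 1%g ->
  (forall j, parabolic (rho := rho) alpha (p (gZ g j))) ->
  (forall j, parabolic (rho := rho) beta (p (gZ g j))) ->
  omega_cocycle p rho (fun x => alpha x + coboundary rho Y x) beta
  = omega_cocycle p rho alpha beta.
Proof.
move=> aZ bZ sY prel aP bP.
(* Tr (dY(x^-1) beta(y)) = phi(xy) - phi(x) - phi(y) for this phi; the potential X becomes X + Y. *)
apply: (omega_iso (phi := fun x => \tr (Y *m beta x))) => //.
- exact/cocycleD/coboundary_cocycle.
- move=> x y; rewrite /cup mulmxDl mxtraceD /coboundary (cocycleM bZ) (homV rhoM).
  rewrite mulmxDr mxtraceD mulmxBl raddfB /= mxtrace_Adl invgK.
  ring.
- move=> z X sX eX; exists (X + Y); split; first exact: slD.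
    by rewrite eX /coboundary raddfD /= opprD addrACA.
  by rewrite mulmxDl mxtraceD.
Qed.

Lemma omega_coboundaryr (alpha beta : Gam -> 'M[R]_n) (Y : 'M[R]_n)
    (g b : nat) (p : gen g b -> Gam) :
  cocycle rho alpha -> cocycle rho beta -> sl Y ->
  weval p (surf_rel g b) = 1%g ->
  (forall j, parabolic (rho := rho) alpha (p (gZ g j))) ->
  (forall j, parabolic (rho := rho) beta (p (gZ g j))) ->
  omega_cocycle p rho alpha (fun x => beta x + coboundary rho Y x)
  = omega_cocycle p rho alpha beta.
Proof.
move=> aZ bZ sY prel aP bP.
(* Here X is kept, and Tr (X dY(z)) = Tr (alpha(z^-1) Y) because alpha(z^-1) = dX(z^-1). *)
apply: (omega_iso (phi := fun x => \tr (alpha x^-1%g *m Y))) => //.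
- exact/cocycleD/coboundary_cocycle.
- move=> x y; rewrite /cup mulmxDr mxtraceD /coboundary (cocycle_VM rhoM aZ).
  rewrite mulmxDl mxtraceD mulmxBr raddfB /= mxtrace_Adr.
  ring.
- move=> z X sX eX; exists X; split=> //.
  rewrite mulmxDr mxtraceD; congr (_ + _).
  rewrite (coboundary_inv rhoM aZ eX) /coboundary (homV rhoM).
  by rewrite mulmxBr mulmxBl !raddfB /= mxtrace_Adr.
- by move=> j; apply: parabolicD => //; exists Y.
Qed.
End Coboundary.
End Omega.

(** * Cohomology classes and restriction to the cut surface *)

Section Classes.
Local Open Scope ring_scope.
Local Open Scope classical_set_scope.
Context {R : realType} {n : nat} {Gam : groupType} {rho : Gam -> PSL R n}.

(** Nonemptiness and inclusion in a class are the form of hypothesis that fits both [coh_class] and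
    [res_class]. *)
Lemma omegaK_cocycle (g b : nat) (p : gen g b -> Gam)
    (alpha beta : Gam -> 'M[R]_n) (a1 a2 : set (Gam -> 'M[R]_n)) :
  is_hom rho -> cocycle rho alpha -> cocycle rho beta ->
  weval p (surf_rel g b) = 1%g ->
  (forall j, parabolic (rho := rho) alpha (p (gZ g j))) ->
  (forall j, parabolic (rho := rho) beta (p (gZ g j))) ->
  a1 !=set0 -> a1 `<=` coh_class rho alpha ->
  a2 !=set0 -> a2 `<=` coh_class rho beta ->
  omegaK p rho a1 a2 = omega_cocycle p rho alpha beta.
Proof.
move=> rhoM aZ bZ prel aP bP a1n sub1 a2n sub2; rewrite /omegaK.
have [X sX eX] := sub1 _ (xgetPex (fun=> 0) a1n).
have [Y sY eY] := sub2 _ (xgetPex (fun=> 0) a2n).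
rewrite (funext eX) (funext eY).
rewrite omega_coboundaryl ?omega_coboundaryr //.
  exact/cocycleD/coboundary_cocycle.
by move=> j; apply: parabolicD => //; exists Y.
Qed.

Lemma coh_class_refl (alpha : Gam -> 'M[R]_n) : coh_class rho alpha alpha.
Proof.
exists 0; first exact: sl0.
by move=> x; rewrite /coboundary raddf0 subr0 addr0.
Qed.

Lemma res_class_sub (Gam0 : groupType) (iota : Gam0 -> Gam)
    (alpha : Gam -> 'M[R]_n) :
  res_class iota rho (coh_class rho alpha)
  `<=` coh_class (rho \o iota) (alpha \o iota).
Proof.
move=> a0 [a [X sX eX] [Y sY eY]]; exists (X + Y); first exact: slD.
move=> x; rewrite eY /= eX -addrA /coboundary raddfD /= opprD.
by rewrite (addrACA (Ad _ X)).
Qed.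

(** This moves the pairing of the cut surface into [Gam], where one extension serves both
    surfaces. *)
Lemma omega_cocycle_comp (Gam0 : groupType) (iota : Gam0 -> Gam) (g b : nat)
    (p0 : gen g b -> Gam0) (alpha beta : Gam -> 'M[R]_n) :
  is_hom iota ->
  omega_cocycle p0 (rho \o iota) (alpha \o iota) (beta \o iota)
  = omega_cocycle (iota \o p0) rho alpha beta.
Proof.
move=> iM; rewrite /omega_cocycle /cup_fund; congr (- _ - _).
apply: eq_bigr => s _; congr (\tr (_ *m _)).
by apply: eq_bigr => c _ /=; rewrite homV // (weval_hom _ _ iM).
Qed.

Lemma rep_class_hom (rho' : Gam -> PSL R n) :
  is_hom rho' -> rep_class rho' rho -> is_hom rho.
Proof. by move=> M [h e] x y; rewrite !e M conjMg. Qed.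

End Classes.

(** * The pairing of the surface and of the cut surface *)

Theorem theorem4p4p1 (R : realType) (n g b : nat) (Gam Gam0 : groupType)
  (iota : Gam0 -> Gam)
  (p : gen g.+1 b -> Gam) (p0 : gen g (b + 2) -> Gam0) (xi : Gam)
  (hyp : hyperbolic g.+1 b) (hyp0 : hyperbolic g (b + 2))
  (pres : surface_presentation p) (pres0 : surface_presentation p0)
  (cut : nonseparating_cut iota p p0 xi)
  (B : 'I_b -> set (PSL R n)) (C : set (PSL R n))
  (frameB : forall j, conj_class (B j)) (frameC : conj_class C)
  (r : set (Gam -> PSL R n))
  (hr : Xbar_frame_at (fun j => p (gZ g.+1 j)) B xi C r)
  (rho : Gam -> PSL R n) (hrho : r rho)
  (hr0 : Xbar_frame (cut_loop p0) (cut_frame B C) (rep_class (rho \o iota)))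
  (a1 a2 : set (Gam -> 'M[R]_n))
  (ha1 : H1par rho (peripheral (fun j => p (gZ g.+1 j)) xi) a1)
  (ha2 : H1par rho (peripheral (fun j => p (gZ g.+1 j)) xi) a2) :
  omegaK p rho a1 a2 =
  omegaK p0 (rho \o iota) (res_class iota rho a1) (res_class iota rho a2).
Proof.
have rhoM : is_hom rho.
  case: hr => -[[rho' [rho'M _ _] er] _] _.
  by apply: (rep_class_hom (rho' := rho')) => //; rewrite er.
have [[h xiE] [t [[iM _ it _] orient]]] := cut.
have pm : (iota \o p0) zminus = (((iota \o p0) zplus)^-1 ^ t)%g.
  by rewrite /= -it homV.
have prel0 : weval (iota \o p0) (surf_rel g (b + 2)) = 1%g.
  by rewrite -weval_hom // pres0.1 hom1.
have gE :
  glued_presentation iota p0 t = glued_presentation id (iota \o p0) t by [].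
have prelg : weval (glued_presentation iota p0 t) (surf_rel g.+1 b) = 1%g.
  by rewrite gE weval_glued.
have par a : Z1par rho (peripheral (fun j => p (gZ g.+1 j)) xi) a ->
    [/\ cocycle rho a, forall j, parabolic (rho := rho) a (p (gZ g.+1 j)),
      forall j, parabolic (rho := rho) a
                  (glued_presentation iota p0 t (gZ g.+1 j))
      & forall j, parabolic (rho := rho) a (iota (p0 (gZ g j)))].
  move=> [aZ aS].
  have self x : cyc x x by exists 1%N; left; rewrite expg1.
  have axi : parabolic (rho := rho) a xi.
    by have [|X sX eX] := aS (cyc xi); [left|exists X => //; apply: eX].
  have ap j : parabolic (rho := rho) a (p (gZ g.+1 j)).
    have [|X sX eX] := aS (cyc (p (gZ g.+1 j))); first by right; exists j.
    by exists X => //; apply: eX.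
  have [w [u [e [wp wz _ _]]]] := orient.
  (* Same orientation makes p(z_j) a conjugate of the glued z_j; the conjugation is undone. *)
  have ag j : parabolic (rho := rho) a (glued_presentation iota p0 t (gZ g.+1 j)).
    have := ap j; rewrite -wp wz weval_conj weval_letter.
    set v := weval _ _; set z := glued_presentation _ _ _ _ => az.
    rewrite (_ : z = (v^-1 * (v * z * v^-1) * v^-1^-1)%g).
      exact: parabolicJ.
    by rewrite !mulgA mulVg mul1g invgK mulgVK.
  split=> // j.
  have az : parabolic (rho := rho) a (iota (p0 zplus)).
    rewrite (_ : iota _ = (h * xi * h^-1)%g); first exact: parabolicJ.
    by rewrite xiE conjgE !mulgA mulgV mul1g mulgK.
  (* The cases are an old boundary component, z+, which is conjugate to xi, and z- = t^-1 z+^-1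
     t. *)
  have [k|k] := fintype.splitP j => jk.
    have -> : j = lshift 2 k by apply: val_inj.
    exact: (ag k).
  have -> : j = rshift b k by apply: val_inj.
  case: k {jk} => -[|[|//]] k2.
    by rewrite (_ : rshift b _ = rshift b ord0) //; apply: val_inj.
  rewrite (_ : rshift b _ = rshift b ord_max); last exact: val_inj.
  rewrite -/zminus -[iota _]/((iota \o p0) zminus) pm conjgE mulgA.
  by rewrite -{2}[t]invgK; apply/parabolicJ/parabolicV.
have [al /par[alZ alp alg al0] <-] := ha1.
have [be /par[beZ bep beg be0] <-] := ha2.
have rho0M : is_hom (rho \o iota) by move=> x y; rewrite /= iM rhoM.
have comp0 a : cocycle rho a -> cocycle (rho \o iota) (a \o iota).
  by move=> [sa aM]; split=> [x|x y] /=; [exact: sa|rewrite iM aM].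
have res0 a : (res_class iota rho (coh_class rho a) !=set0)%classic.
  by exists (a \o iota); exists a; exact: coh_class_refl.
rewrite (omegaK_cocycle rhoM alZ beZ pres.1 alp bep) //;
  do ?by eexists; exact: coh_class_refl.
rewrite (omegaK_cocycle rho0M (comp0 _ alZ) (comp0 _ beZ) pres0.1) //;
  try exact: res_class_sub.
(* The cut presentation is pushed into [Gam] and glued; the glued presentation is then exchanged for
   p. *)
rewrite omega_cocycle_comp // -(omega_glued rhoM alZ beZ pm prel0 al0 be0) -gE.
exact: (omega_same_orientation rhoM alZ beZ prelg alg beg orient).
Qed.
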